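(* Let $k\ge1$ and let $S$ be an $m$-vertex $k$-stellated triangulated sphere of dimension $d\ge 2k-1$. Then, with respect to any field $\mathbb{F}$, the sigma-vector $(\sigma_0,\dots,\sigma_d)$ of $S$ is related to its $g$-vector $(g_0,\dots,g_{d+1})$ by: (a) $\sigma_i=0$ for $k\le i\le d-k-1$; (b) $\displaystyle\sum_{i=0}^{l}(-1)^{l-i}\sigma_i\ \le\ \frac{m+1}{d+3}\sum_{i=0}^{l+1}(-1)^{l+1-i}\frac{g_i}{\binom{d+2}{i}}$ for $0\le l\le k-2$; (c) $\displaystyle\sum_{i=0}^{l}(-1)^{l-i}\sigma_i\ =\ \frac{m+1}{d+3}\sum_{i=0}^{l+1}(-1)^{l+1-i}\frac{g_i}{\binom{d+2}{i}}$ for $k-1\le l\le d-k-1$.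
   Context: All simplicial complexes are finite and abstract, and the empty set is a face of each; isomorphic complexes are identified. For a finite set $\alpha$, $\overline\alpha$ is the complex of all subsets of $\alpha$ and $\partial\alpha$ the complex of all proper subsets of $\alpha$; $X*Y$ denotes the join. If $X$ is a $d$-dimensional complex and $\overline\alpha*\partial\beta$ ($\alpha,\beta\ne\emptyset$ disjoint, $\dim\alpha+\dim\beta=d$, where $\dim\alpha=\#(\alpha)-1$) is the induced subcomplex of $X$ on $\alpha\sqcup\beta$ (if $\beta$ is a single element this means that $\alpha\in X$ and $\beta$ is a new vertex not in $X$), then $Y=(X\setminus(\overline\alpha*\partial\beta))\cup(\partial\alpha*\overline\beta)$ is said to be obtained from $X$ by the bistellar move $\alpha\mapsto\beta$, of index $\dim\beta$. $S^{d}_{d+2}$ denotes the standard $d$-sphere, i.e. $\partial\gamma$ with $\#(\gamma)=d+2$. For $0\le k\le d+1$, a $d$-dimensional complex is $k$-stellated if it can be obtained from $S^d_{d+2}$ by a finite sequence of bistellar moves, each of index $<k$ (so $S^d_{d+2}$ is the only $0$-stellated one); such complexes are triangulated spheres. For a $d$-dimensional complex $X$, $f_i$ is the number of $i$-dimensional faces ($f_{-1}=1$) and the $g$-vector is $$g_j(X)=\sum_{i=-1}^{j-1}(-1)^{j-i-1}\binom{d-i+1}{j-i-1}f_i(X),\quad 0\le j\le d+1.$$ Homology is simplicial with coefficients in $\mathbb F$, and $\beta_i=\dim_{\mathbb F}H_i$. Reduced Betti numbers: $\widetilde\beta_i=\beta_i$ for $i\ne0$, $\widetilde\beta_0=\beta_0-1$;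 in particular, for the complex $\emptyset$ whose only face is the empty set, $\widetilde\beta_0(\emptyset)=-1$ and $\widetilde\beta_i(\emptyset)=0$ for $i\ne0$. With $X[A]=\{\alpha\in X:\alpha\subseteq A\}$, the sigma-vector of an $m$-vertex complex $X$ of dimension $d$ with vertex set $V(X)$ is $$\sigma_i(X)=\sum_{j=0}^{m}\frac{1}{\binom mj}\sum_{A\subseteq V(X),\ \#(A)=j}\widetilde\beta_i(X[A]),\quad 0\le i\le d.$$ *)

(* Defs.v *)
From mathcomp Require Import all_boot all_order all_algebra.
From mathcomp Require Import finmap.

Set Implicit Arguments.
Unset Strict Implicit.
Unset Printing Implicit Defensive.

Import Order.TTheory GRing.Theory Num.Theory.

Local Open Scope fset_scope.
Local Open Scope ring_scope.

(* Vertices are natural numbers, which realizes every isomorphism class of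
   finite complexes, leaves a new vertex available for every bistellar move
   of index 0, and orders each face for the signs of the boundary operator. *)
Notation face := {fset nat}.
Notation faceset := {fset {fset nat}}.

Definition is_complex (X : faceset) : Prop :=
  fset0 \in X /\
  forall s t : face, s \in X -> t `<=` s -> t \in X.

(* Truncated: used only for s nonempty. *)
Definition face_dim (s : face) : nat := #|` s|.-1.

Definition complex_dim (X : faceset) : int :=
  (\max_(s <- X) #|` s|)%N%:Z - 1.

Definition vertices (X : faceset) : {fset nat} := \bigcup_(s <- X) s.

Definition induced (X : faceset) (A : {fset nat}) : faceset :=
  [fset s in X | s `<=` A].

Definition simplex (s : face) : faceset := fpowerset s.

Definition simplex_boundary (s : face) : faceset := fpowerset s `\ s.

Definition join (X Y : faceset) : faceset :=
  [fset s `|` t | s in X, t in Y].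

Definition bistellar_move (d : nat) (X : faceset) (a b : face)
    (Y : faceset) : Prop :=
  [/\ is_complex X /\ complex_dim X = d%:Z,
      [/\ a != fset0, b != fset0 & [disjoint a & b]%fset],
      (face_dim a + face_dim b)%N = d,
      induced X (a `|` b) = join (simplex a) (simplex_boundary b) &
      Y = (X `\` join (simplex a) (simplex_boundary b))
          `|` join (simplex_boundary a) (simplex b)].

Inductive stellated (k d : nat) : faceset -> Prop :=
| stellated_sphere (c : face) :
    #|` c| = d.+2 -> stellated k d (simplex_boundary c)
| stellated_move (X Y : faceset) (a b : face) :
    stellated k d X -> bistellar_move d X a b Y -> (face_dim b < k)%N ->
    stellated k d Y.

(* Faces are graded by cardinality: faces_card X n is the set of
   (n-1)-dimensional faces, so that n = 0 accounts for f_(-1). *)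
Definition faces_card (X : faceset) (n : nat) : faceset :=
  [fset s in X | #|` s| == n].

(* The sum over -1 <= i <= j - 1 is reindexed by n = i + 1. *)
Definition g_vector (d : nat) (X : faceset) (j : nat) : int :=
  \sum_(0 <= n < j.+1)
    (-1) ^+ (j - n) * 'C(d.+2 - n, j - n)%:R * #|` faces_card X n|%:R.

Section Homology.
Variable F : fieldType.

(* The coefficient of t in the boundary of s, both oriented by the order on
   nat: deleting the p-th smallest vertex (from p = 0) has sign (-1)^p. *)
Definition incidence (s t : face) : F :=
  \sum_(v <- s | s `\ v == t) (-1) ^+ #|` [fset w in s | (w < v)%N]|.

(* The boundary operator from n-chains to (n-1)-chains, acting on row
   vectors; the augmentation when n = 0. *)
Definition boundary (X : faceset) (n : nat) :
    'M[F]_(#|` faces_card X n.+1|, #|` faces_card X n|) :=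
  \matrix_(i, j) incidence (nth fset0 (faces_card X n.+1) i)
                           (nth fset0 (faces_card X n) j).

(* Row space: the n-cycles, all 0-chains being cycles (unreduced homology). *)
Definition cycles (X : faceset) (n : nat) : 'M[F]_#|` faces_card X n.+1| :=
  if n == 0%N then 1%:M else kermx (boundary X n).

(* dim Z_n - dim B_n; no truncation occurs when X is a complex. *)
Definition betti (X : faceset) (n : nat) : nat :=
  (\rank (cycles X n) - \rank (boundary X n.+1))%N.

Definition reduced_betti (X : faceset) (n : nat) : int :=
  (betti X n)%:Z - (n == 0%N)%:Z.

Definition sigma_vector (X : faceset) (i : nat) : rat :=
  let m := #|` vertices X| in
  \sum_(0 <= j < m.+1)
    ('C(m, j)%:R)^-1 *
    \sum_(A <- fpowerset (vertices X) | #|` A| == j)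
      (reduced_betti (induced X A) i)%:~R.

End Homology.

(* Main.v *)
Require Import Defs.
From mathcomp Require Import all_boot all_order all_algebra.
From mathcomp Require Import finmap zify ring.

(** Consider the alternating sum of the reduced Betti numbers up to degree [l]
    of an induced subcomplex, [alt_betti].  Since the ranks of the boundary
    operators cancel in pairs, it equals an Euler characteristic truncated at
    dimension [l] minus the rank of one boundary operator
    ([sum_reduced_betti]); it depends only on the faces with at most [l + 2]
    vertices.

    A bistellar move [a |-> b] of index less than [k] deletes only faces
    containing [a], which has at least [d + 2 - k] vertices.  For
    [l + k + 1 <= d] these are too large to matter, and the move merely adjoins
    the faces [s] with [b `<=` s] and [s `<=` b `|` a].  In the induced
    subcomplex on a vertex set [A], nothing happens if [A] does not contain [b];
    if [A] contains [b] and meets [a], faces are added by the inverse of a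
    collapse, and [alt_betti] does not change ([alt_betti_add_interval]); if
    [A] contains [b] and is disjoint from [a], the single face [b] is added, and
    [alt_betti] changes by an explicit sign when [#|` b| <= l + 1], decreases by
    at most 1 when [#|` b| = l + 2], and does not change otherwise
    ([alt_betti_add_face]).

    The sigma-vector weights of the sets [A] of the last kind add up to
    [(m + 1) / ((d + 3) 'C(d + 2, #|` b|))], by the recurrence of the harmonic
    triangle ([sum_powerset_harmonic]).  On the other side the move increases
    the g-number of index [#|` b|] by 1 and fixes the other low ones
    ([g_vector_interval]).  So both sides of the claim change by the same amount,
    except for the possible decrease when [#|` b| = l + 2], which is the
    inequality and which is excluded when [k <= l + 1] ([defect_step]).  The
    standard sphere fits the same pattern: its low faces are adjoined to the
    complex without faces by the step with [b] empty, and induction over the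
    moves gives the inequality and the equality.

    Finally, no step has [#|` b| > k], so the g-numbers of index between [k + 1]
    and [d - k] vanish; adding the equalities for consecutive [l] then yields
    the vanishing of the sigma-vector. *)

Set Implicit Arguments.
Unset Strict Implicit.
Unset Printing Implicit Defensive.

Import Order.TTheory GRing.Theory Num.Theory.

Local Open Scope fset_scope.
Local Open Scope ring_scope.

(** * Sums over power sets and face intervals *)

Lemma big_fpowersetU1 (I : choiceType) (R : Type) (idx : R)
    (op : Monoid.com_law idx) (u : I) (U : {fset I}) (G : {fset I} -> R) :
  u \notin U ->
  \big[op/idx]_(B <- fpowerset (u |` U)) G B =
  op (\big[op/idx]_(B <- fpowerset U) G B)
     (\big[op/idx]_(B <- fpowerset U) G (u |` B)).
Proof.
move=> uU.
rewrite -(big_map (fun B => u |` B) xpredT G) -big_cat.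
have nu (B : {fset I}) : B \in fpowerset U -> u \notin B.
  by rewrite fpowersetE => /fsubsetP h; apply: contra uU; apply: h.
apply/perm_big/uniq_perm.
- exact: fset_uniq.
- rewrite cat_uniq fset_uniq map_inj_in_uniq ?fset_uniq ?andbT /=.
    apply/hasPn => _ /mapP[B _ ->]; apply/negP => /nu.
    by rewrite fset1U1.
  by move=> B C /nu hB /nu hC e; rewrite -(fsetU1K hB) e fsetU1K.
move=> B; rewrite mem_cat fpowersetE; apply/idP/orP => [sB | [] ].
- have [uB | uB] := boolP (u \in B); last first.
    left; rewrite fpowersetE; apply/fsubsetP => x xB.
    move/fsubsetP: sB => /(_ x xB); rewrite !inE => /orP[/eqP e|//].
    by rewrite e (negPf uB) in xB.
  right; apply/mapP; exists (B `\ u); last by rewrite fsetD1K.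
  by rewrite fpowersetE fsubDset.
- by rewrite fpowersetE => /fsubset_trans; apply; apply: fsubsetU1.
- by case/mapP => C; rewrite fpowersetE => sC ->; apply: fsetUS.
Qed.

Lemma big_fsetU_disjoint (R : Type) (idx : R) (op : Monoid.com_law idx)
    (I : choiceType) (X Y : {fset I}) (G : I -> R) :
  [disjoint X & Y]%fset ->
  \big[op/idx]_(s <- X `|` Y) G s =
  op (\big[op/idx]_(s <- X) G s) (\big[op/idx]_(s <- Y) G s).
Proof.
move=> /fdisjointP dXY; rewrite -big_cat; apply/perm_big/uniq_perm.
- exact: fset_uniq.
- rewrite cat_uniq !fset_uniq andbT /=; apply/hasPn => s sY.
  by apply: contraL sY; apply: dXY.
- by move=> s; rewrite mem_cat in_fsetU.
Qed.

(** The faces created by a bistellar move [a |-> b] are those in the interval from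
    [b] to [b `|` a], except [b `|` a] itself. *)
Definition face_interval (b c : face) : faceset :=
  [fset s in fpowerset c | b `<=` s].

Lemma mem_face_interval b c s : (s \in face_interval b c) = (b `<=` s) && (s `<=` c).
Proof. by rewrite !inE /= fpowersetE andbC. Qed.

Lemma big_face_interval (R : Type) (idx : R) (op : Monoid.com_law idx) (b p : face)
    (G : face -> R) :
  [disjoint b & p]%fset ->
  \big[op/idx]_(s <- face_interval b (b `|` p)) G s =
  \big[op/idx]_(t <- fpowerset p) G (b `|` t).
Proof.
move=> dbp; rewrite -(big_map (fun t => b `|` t) xpredT G).
have h t : t \in fpowerset p -> (b `|` t) `\` b = t.
  rewrite fpowersetE => tp; rewrite fsetDUl fsetDv fset0U.
  by apply/fsetDidPl; rewrite fdisjoint_sym (fdisjointWr tp).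
apply/perm_big/uniq_perm.
- exact: fset_uniq.
- rewrite map_inj_in_uniq ?fset_uniq //.
  by move=> B C /h hB /h hC e; rewrite -hB e.
move=> s; rewrite mem_face_interval; apply/andP/mapP => [[bs sbp] | [t tp ->]].
- exists (s `\` b); first by rewrite fpowersetE fsubDset.
  by rewrite fsetUDl fsetDv fsetD0; apply/esym/fsetUidPr.
- by rewrite fsubsetUl; split=> //; apply: fsetUS; rewrite -fpowersetE.
Qed.

Lemma alternating_sumS (R : pzRingType) (x : nat -> R) (N : nat) :
  \sum_(0 <= i < N.+2) (-1) ^+ (N.+1 - i) * x i =
  x N.+1 - \sum_(0 <= i < N.+1) (-1) ^+ (N - i) * x i.
Proof.
rewrite big_nat_recr //= subnn mul1r addrC -sumrN; congr (_ + _).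
by apply: eq_big_nat => i /andP[_ iN]; rewrite subSn // exprS mulN1r mulNr.
Qed.

(** * Sums over faces, graded by cardinality *)

(** A linear expression in the f-vector is a sum over faces of a weight that
    depends on the cardinality, which makes it additive under adjoining faces. *)
Lemma sum_faces_card (R : pzRingType) (X : faceset) (N : nat) (c : nat -> R) :
  \sum_(0 <= n < N) c n * #|` faces_card X n|%:R =
  \sum_(s <- X) (if (#|` s| < N)%N then c #|` s| else 0).
Proof.
under eq_bigr => n _.
  rewrite card_fset_sum1 big_fset /= natr_sum mulr_sumr.
  over.
rewrite (exchange_big_dep xpredT) //=; apply: eq_bigr => s _.
rewrite big_mkcond /=; case: ltnP => h.
  rewrite (bigD1_seq #|` s|) ?iota_uniq ?mem_index_iota //= eqxx mulr1.
  by rewrite big1 ?addr0 // => n; rewrite eq_sym => /negPf->.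
rewrite big1_seq // => n; rewrite mem_index_iota => /andP[_ nN].
by case: eqP => // e; move: nN; rewrite -e; lia.
Qed.

Lemma cardfsU1_powerset (x : nat) (X B : face) :
  x \notin X -> B \in fpowerset X -> #|` x |` B| = #|` B|.+1.
Proof.
rewrite fpowersetE => xX /fsubsetP sB; rewrite cardfsU1.
by rewrite (contra _ xX) //; apply: sB.
Qed.

(** The recurrence of the Leibniz harmonic triangle. *)
Lemma leibniz_harmonic (a b : nat) :
  (a + b).+2%:R^-1 * ('C((a + b).+1, b)%:R^-1 + 'C((a + b).+1, b.+1)%:R^-1)
  = (a + b).+1%:R^-1 / 'C(a + b, b)%:R :> rat.
Proof.
have h1 : ((a + b).+1 * 'C(a + b, b) = a.+1 * 'C((a + b).+1, b))%N.
  by rewrite (mul_bin_down (a + b).+1 b) -addSn addnK.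
have h2 : ((a + b).+1 * 'C(a + b, b) = b.+1 * 'C((a + b).+1, b.+1))%N.
  by rewrite mul_bin_diag.
move: (congr1 (fun n => n%:R : rat) h1) (congr1 (fun n => n%:R : rat) h2).
rewrite !natrM.
have c0 : ('C(a + b, b)%:R : rat) != 0.
  by rewrite pnatr_eq0 -lt0n bin_gt0 leq_addl.
have c1 : ('C((a + b).+1, b)%:R : rat) != 0.
  by rewrite pnatr_eq0 -lt0n bin_gt0; lia.
have c2 : ('C((a + b).+1, b.+1)%:R : rat) != 0.
  by rewrite pnatr_eq0 -lt0n bin_gt0; lia.
have n1 : ((a + b).+1%:R : rat) != 0 by rewrite pnatr_eq0.
have n2 : ((a + b).+2%:R : rat) != 0 by rewrite pnatr_eq0.
have n3 : (a.+1%:R : rat) != 0 by rewrite pnatr_eq0.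
have n4 : (b.+1%:R : rat) != 0 by rewrite pnatr_eq0.
move=> e1 e2.
have -> : ('C((a + b).+1, b)%:R : rat)^-1
          = a.+1%:R / ((a + b).+1%:R * 'C(a + b, b)%:R).
  rewrite e1; move: c1 n3; move: (_%:R) (_%:R) => x y *; field.
  by do ?[apply/andP; split].
have -> : ('C((a + b).+1, b.+1)%:R : rat)^-1
          = b.+1%:R / ((a + b).+1%:R * 'C(a + b, b)%:R).
  rewrite e2; move: c2 n4; move: (_%:R) (_%:R) => x y *; field.
  by do ?[apply/andP; split].
move: n1 c0 n2; have -> : (a + b).+2%:R = a.+1%:R + b.+1%:R :> rat.
  by rewrite -natrD addSn addnS.
clear; move: ((a + b).+1%:R : rat) (a.+1%:R : rat) (b.+1%:R : rat).
move: ('C(a + b, b)%:R : rat) => x y z w *.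
by field; do ?[apply/andP; split].
Qed.

(** Both sides satisfy the recurrence of the harmonic triangle: a point of [U]
    is either kept out of the sets that are summed over, which increases [a],
    or put into all of them, which increases [b].  The sum is the total
    weight that the sigma-vector of a complex with [a + b + #|` U|] vertices
    gives to the sets containing [b] given vertices and avoiding [a] others. *)
Lemma sum_powerset_harmonic (a b : nat) (U : face) :
  \sum_(B <- fpowerset U) ('C(a + b + #|` U|, b + #|` B|)%:R : rat)^-1 =
  (a + b + #|` U|).+1%:R / (a + b).+1%:R / 'C(a + b, b)%:R.
Proof.
elim/fset1U_rect: U a b => [|x X xX IH] a b.
  rewrite fpowerset0 big_seq_fset1 cardfs0 !addn0 mulfV ?mul1r //.
  by rewrite pnatr_eq0.
rewrite big_fpowersetU1 //= (cardfsU1 x X) xX add1n addnS.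
have e1 := IH a.+1 b; have e2 := IH a b.+1.
rewrite !addSn in e1; rewrite !addnS !addSn in e2.
transitivity (\sum_(B <- fpowerset X)
    ('C((a + b + #|` X|).+1, b + #|` B|)%:R : rat)^-1 +
  \sum_(B <- fpowerset X) ('C((a + b + #|` X|).+1, b.+1 + #|` B|)%:R : rat)^-1).
  congr (_ + _); apply: eq_big_seq => B hB.
  by rewrite (cardfsU1_powerset xX hB) addnS.
by rewrite e1 e2 -!mulrA -mulrDr -mulrDr leibniz_harmonic.
Qed.

(** The weight in the g-number of index [j], with [D] in the role of the
    dimension plus 2, of a face with [n] vertices. *)
Definition g_coef (D j n : nat) : int :=
  if (n < j.+1)%N then (-1) ^+ (j - n) * 'C(D - n, j - n)%:R else 0.

Lemma g_coefS D j n : (n < D)%N -> g_coef D j n + g_coef D j n.+1 = g_coef D.-1 j n.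
Proof.
move=> nD; rewrite /g_coef !ltnS; case: (ltngtP n j) => [nj|nj|->].
- rewrite (_ : j - n = (j - n.+1).+1)%N; last by lia.
  rewrite (_ : D - n = (D - n.+1).+1)%N; last by lia.
  rewrite (_ : D.-1 - n = (D - n.+1))%N; last by lia.
  by rewrite binS natrD exprS; ring.
- by rewrite addr0.
- by rewrite addr0 subnn !bin0.
Qed.

(** The reason why adjoining an interval of faces, the smallest of which has [b]
    vertices, changes only the g-number of index [b]: pairing the faces with and
    without a given vertex of [U] lowers the first parameter of [g_coef] by one,
    until only the smallest face is left. *)
Lemma sum_powerset_g_coef (b j : nat) (U : face) :
  \sum_(t <- fpowerset U) g_coef (b + #|` U|) j (b + #|` t|) = (j == b)%:R.
Proof.
elim/fset1U_rect: U => [|x X xX IH].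
  rewrite fpowerset0 big_seq_fset1 cardfs0 !addn0 /g_coef ltnS subnn.
  case: (ltngtP b j) => [bj|//|->].
  - by rewrite bin0n subn_eq0 leqNgt bj mulr0.
  - by rewrite subnn mulr1.
rewrite big_fpowersetU1 //= (cardfsU1 x X) xX add1n addnS -IH -big_split /=.
apply: eq_big_seq => B hB; rewrite (cardfsU1_powerset xX hB) addnS g_coefS //.
rewrite ltnS leq_add2l; apply: fsubset_leq_card; by rewrite -fpowersetE.
Qed.

(** The weight of a face with [n] vertices in the Euler characteristic
    truncated at dimension [l], signed so that dimension [l] counts
    positively. *)
Definition euler_coef (l n : nat) : int :=
  if (n < l.+2)%N then (-1) ^+ (l.+1 - n) else 0.

Lemma euler_coefS l n : euler_coef l n + euler_coef l n.+1 = (n == l.+1)%:R.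
Proof.
rewrite /euler_coef !ltnS; case: (ltngtP n l.+1) => [nl|nl|->].
- by rewrite ifT // subSS subSn // exprS mulN1r addNr.
- by rewrite add0r ifF //; lia.
- by rewrite ltnn subnn addr0.
Qed.

(** * The boundary operator squares to zero *)

(** The complex without any face, not even the empty one, is admitted: it is
    the complex from which the standard sphere arises by adjoining faces. *)
Definition subset_closed (X : faceset) :=
  forall s t : face, s \in X -> t `<=` s -> t \in X.

Lemma mem_faces_card X n s : (s \in faces_card X n) = (s \in X) && (#|` s| == n).
Proof. by rewrite !inE. Qed.

Lemma card_facet (v : nat) (s : face) n :
  v \in s -> #|` s| = n.+1 -> #|` s `\ v| = n.
Proof. by move=> vs; rewrite (cardfsD1 v) vs => -[]. Qed.

Section Chains.
Variable F : fieldType.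

Definition vertex_sign (v : nat) (s : face) : F :=
  (-1) ^+ #|` [fset w in s | (w < v)%N]|.

Lemma incidence_facet v s : v \in s -> incidence F s (s `\ v) = vertex_sign v s.
Proof.
move=> vs; rewrite /incidence big_mkcond (big_fsetD1 v vs) /= eqxx.
rewrite big_seq big1 ?addr0 // => w; rewrite !inE => /andP[wv ws].
case: eqP => // /fsetP/(_ v); rewrite !inE eqxx vs andbT /=.
by rewrite eq_sym wv.
Qed.

Lemma incidence_neq0 s t : incidence F s t != 0 -> exists2 v, v \in s & t = s `\ v.
Proof.
move=> h; suff /hasP[v vs /eqP <-] : has (fun v => s `\ v == t) s by exists v.
apply: contraNT h => /hasPn h; rewrite /incidence big_seq_cond big1 //.
by move=> v /andP[/h/negPf->].
Qed.

Lemma vertex_sign_facet v w s : v \in s ->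
  vertex_sign w s = (-1) ^+ (v < w)%N * vertex_sign w (s `\ v).
Proof.
move=> vs; rewrite /vertex_sign -exprD; congr (_ ^+ _).
rewrite (cardfsD1 v) !inE /= vs /=; congr (_ + _)%N; congr (#|` _|).
by apply/fsetP => x; rewrite !inE /= andbA.
Qed.

(** The two orders of deleting a pair of vertices contribute opposite signs.
    The identity involves no complex: [s] itself may be a missing face all of
    whose facets are present. *)
Lemma boundary_boundary (s u : face) :
  \sum_(v <- s) vertex_sign v s * incidence F (s `\ v) u = 0.
Proof.
pose T v w := if (w != v) && (s `\ v `\ w == u)
              then vertex_sign v s * vertex_sign w (s `\ v) else 0.
have Tanti v w : v \in s -> w \in s -> (v < w)%N -> T v w + T w v = 0.
  move=> vs ws vw; rewrite /T eq_sym.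
  have -> : s `\ v `\ w = s `\ w `\ v.
    by apply/fsetP => x; rewrite !inE andbCA.
  case: ifP => _; last by rewrite addr0.
  rewrite (vertex_sign_facet w vs) (vertex_sign_facet v ws) vw ltnNge (ltnW vw) /=.
  by rewrite expr0 expr1 mul1r; ring.
transitivity (\sum_(v <- s) \sum_(w <- s) T v w).
  apply: eq_big_seq => v vs; rewrite /incidence (big_fsetD1 v vs) /= /T eqxx add0r.
  rewrite mulr_sumr big_mkcond /=; apply: eq_big_seq => w.
  by rewrite !inE => /andP[-> _].
(* Pairs are split by their order, since antisymmetry alone would not give
   zero in characteristic 2. *)
transitivity (\sum_(v <- s) \sum_(w <- s) (if (v < w)%N then T v w else 0) +
              \sum_(v <- s) \sum_(w <- s) (if (w < v)%N then T v w else 0)).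
  rewrite -big_split; apply: eq_bigr => v _; rewrite -big_split.
  apply: eq_bigr => w _ /=; case: (ltngtP v w) => [||->].
  - by rewrite addr0.
  - by rewrite add0r.
  - by rewrite /T eqxx addr0.
rewrite [X in _ + X]exchange_big -big_split big_seq big1 // => v vs.
rewrite -big_split big_seq big1 //= => w ws.
by case: ifP => [vw|]; [exact: Tanti | rewrite addr0].
Qed.

(** * Rank of the boundary operator as the rank of a span *)

(** Boundaries are taken in the coordinates of a large family [K] of faces, so
    that those of different complexes live in one vector space. *)
Section Span.
Variable K : faceset.

Definition boundary_row (s : face) : 'rV[F]_#|` K| :=
  \row_j incidence F s (nth fset0 K j).

Definition boundary_span (r : seq face) : 'M[F]_#|` K| :=
  (\sum_(s <- r) <<boundary_row s>>)%MS.

Lemma boundary_row_sub_span r s : s \in r -> (boundary_row s <= boundary_span r)%MS.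
Proof.
move=> sr; rewrite /boundary_span (perm_big _ (perm_to_rem sr)) big_cons.
by apply: (submx_trans _ (addsmxSl _ _)); rewrite genmxE.
Qed.

Lemma boundary_span_sub r m (U : 'M[F]_(m, _)) :
  (forall s, s \in r -> (boundary_row s <= U)%MS) -> (boundary_span r <= U)%MS.
Proof.
elim: r => [|s r IH] h; first by rewrite /boundary_span big_nil sub0mx.
rewrite /boundary_span big_cons addsmx_sub genmxE h ?mem_head //=.
by apply: IH => t tr; rewrite h // inE tr orbT.
Qed.

Lemma rank_boundary_span_le r r' :
  (forall s, s \in r -> (boundary_row s <= boundary_span r')%MS) ->
  (\rank (boundary_span r) <= \rank (boundary_span r'))%N.
Proof. by move=> h; apply/mxrankS/boundary_span_sub. Qed.

(** Each face of [r'] has a pivot coordinate [c s] at which all other boundaries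
    vanish, so each one increases the rank. *)
Lemma rank_boundary_span_pivot (r r' : seq face) (c : face -> face) :
  uniq r' ->
  (forall s, s \in r' -> c s \in K) ->
  (forall s, s \in r' -> incidence F s (c s) != 0) ->
  (forall s t, s \in r' -> t \in r' ++ r -> t != s -> incidence F t (c s) = 0) ->
  (forall s, s \in r' -> s \notin r) ->
  \rank (boundary_span (r' ++ r)) = (size r' + \rank (boundary_span r))%N.
Proof.
elim: r' => [//|s r' IH] /= /andP[sr' ur'] hK hn hz hd.
rewrite addSn -IH //; last first.
- by move=> t tr; rewrite hd // inE tr orbT.
- by move=> t w tr wr; apply: hz; rewrite inE ?tr ?wr orbT.
- by move=> t tr; rewrite hn // inE tr orbT.
- by move=> t tr; rewrite hK // inE tr orbT.
have h0 := hn s (mem_head _ _).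
have cK : (index (c s) K < #|` K|)%N by rewrite index_mem hK ?mem_head.
pose j := Ordinal cK.
have bj t : boundary_row t 0 j = incidence F t (c s).
  by rewrite mxE /= nth_index // hK ?mem_head.
have rk1 : \rank <<boundary_row s>>%MS = 1%N.
  rewrite genmxE rank_rV; case: eqP => // e; move: h0; rewrite -bj e mxE.
  by rewrite eqxx.
have sp0 : (boundary_span (r' ++ r) <= kermx (delta_mx j (0 : 'I_1)))%MS.
  apply: boundary_span_sub => t tr; apply/sub_kermxP; rewrite -colE.
  apply/matrixP => a b; rewrite !ord1 mxE bj mxE hz ?mem_head //.
    by rewrite inE tr orbT.
  apply: contraTneq tr => ->; rewrite mem_cat (negPf sr') /=.
  exact/hd/mem_head.
rewrite /boundary_span /= big_cons mxrank_disjoint_sum ?rk1 //.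
apply/eqP; rewrite -submx0; apply/rV_subP => x; rewrite sub_capmx genmxE.
case/andP => /sub_rVP[a ->] /submx_trans/(_ sp0)/sub_kermxP.
rewrite -colE => /matrixP/(_ 0 0); rewrite mxE [LHS]mxE bj mxE => /eqP.
by rewrite mulf_eq0 (negPf h0) orbF => /eqP ->; rewrite scale0r sub0mx.
Qed.

(** The additional columns indexed by [K] are zero, because the facets of a face
    of [X] are in [X]. *)
Lemma rank_boundary (X : faceset) (n : nat) :
  subset_closed X -> faces_card X n `<=` K ->
  \rank (boundary F X n) = \rank (boundary_span (faces_card X n.+1)).
Proof.
move=> cX /fsubsetP sK.
pose A := faces_card X n.+1; pose B := faces_card X n.
pose M : 'M[F]_(#|` A|, #|` K|) := \matrix_(i < #|` A|) boundary_row (nth fset0 A i).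
have -> : \rank (boundary_span A) = \rank M.
  apply/eqP; rewrite eqn_leq; apply/andP; split; apply: mxrankS.
    apply: boundary_span_sub => s sA.
    have iA : (index s A < #|` A|)%N by rewrite index_mem.
    by apply: (eq_row_sub (Ordinal iA)); rewrite rowK /= nth_index.
  by apply/row_subP => i; rewrite rowK; apply/boundary_row_sub_span/mem_nth.
pose P : 'M[F]_(#|` B|, #|` K|) :=
  \matrix_(j, j') (nth fset0 B j == nth fset0 K j')%:R.
have inB i (j' : 'I_#|` K|) : incidence F (nth fset0 A i) (nth fset0 K j') != 0 ->
    (i < #|` A|)%N -> nth fset0 K j' \in B.
  move=> /incidence_neq0[v vs ->] iA.
  have := mem_nth fset0 iA; rewrite !mem_faces_card => /andP[sX /eqP sn].
  rewrite (card_facet vs sn) eqxx andbT; apply: cX sX _; exact: fsubD1set.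
have e1 : M = boundary F X n *m P.
  apply/matrixP => i j'; rewrite !mxE.
  have [j'B|j'B] := boolP (nth fset0 K j' \in B).
    have jB : (index (nth fset0 K j') B < #|` B|)%N by rewrite index_mem.
    rewrite (bigD1 (Ordinal jB)) //= !mxE /= nth_index // eqxx mulr1.
    rewrite big1 ?addr0 // => j /eqP jj; rewrite !mxE.
    case: eqP => e; last by rewrite mulr0.
    case: jj; apply: val_inj => /=; rewrite -e index_uniq ?fset_uniq //.
  rewrite big1 => [|j _].
    by apply/eqP; apply: contraNT j'B => /inB; apply.
  rewrite !mxE; case: eqP => e; last by rewrite mulr0.
  by rewrite -e mem_nth in j'B.
have e2 : boundary F X n = M *m P^T.
  apply/matrixP => i j; rewrite !mxE.
  have jK : nth fset0 B j \in K by apply/sK/mem_nth.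
  have kK : (index (nth fset0 B j) K < #|` K|)%N by rewrite index_mem.
  rewrite (bigD1 (Ordinal kK)) //= !mxE /= nth_index // eqxx mulr1.
  rewrite big1 ?addr0 // => k /eqP kk; rewrite !mxE.
  case: eqP => e; last by rewrite mulr0.
  by case: kk; apply: val_inj; rewrite /= e index_uniq ?fset_uniq.
apply/eqP; rewrite eqn_leq; apply/andP; split.
  by rewrite e2 mxrankM_maxl.
by rewrite [X in (\rank X <= _)%N]e1 mxrankM_maxl.
Qed.

End Span.

(** * Alternating sums of reduced Betti numbers *)

Lemma boundary_mul0 (X : faceset) (n : nat) :
  subset_closed X -> boundary F X n.+1 *m boundary F X n = 0.
Proof.
move=> cX; apply/matrixP => i k; rewrite !mxE.
set s := nth fset0 (faces_card X n.+2) i.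
set u := nth fset0 (faces_card X n) k.
have : s \in faces_card X n.+2 by apply: mem_nth.
rewrite mem_faces_card => /andP[sX /eqP sn].
apply: etrans (boundary_boundary s u).
transitivity (\sum_(t <- faces_card X n.+1) incidence F s t * incidence F t u).
  by rewrite (big_nth fset0) big_mkord; apply: eq_bigr => j _; rewrite !mxE.
under eq_bigr => t _ do rewrite {1}/incidence mulr_suml big_mkcond.
rewrite exchange_big; apply: eq_big_seq => v vs /=.
have sv : s `\ v \in faces_card X n.+1.
  rewrite mem_faces_card (card_facet vs sn) eqxx andbT.
  by apply: cX sX _; exact: fsubD1set.
rewrite (bigD1_seq _ sv) ?fset_uniq //= eqxx big1 ?addr0 // => t.
by rewrite eq_sym => /negPf->.
Qed.

(** The alternating sum of the reduced Betti numbers up to degree [l], in the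
    form that remains after the ranks of the lower boundary operators have
    cancelled in pairs: a single rank survives. *)
Definition alt_betti (X : faceset) (l : nat) : int :=
  \sum_(0 <= n < l.+2) (-1) ^+ (l.+1 - n) * #|` faces_card X n|%:R
  - (\rank (boundary F X l.+1))%:R.

Lemma alt_bettiE X l :
  alt_betti X l = \sum_(s <- X) euler_coef l #|` s| - (\rank (boundary F X l.+1))%:R.
Proof. by rewrite /alt_betti sum_faces_card. Qed.

Lemma reduced_betti0 X :
  reduced_betti F X 0 =
  #|` faces_card X 1|%:R - 1 - (\rank (boundary F X 1))%:R.
Proof.
rewrite /reduced_betti /betti /cycles /= mxrank1 -subzn ?rank_leq_col //.
by rewrite !natz; ring.
Qed.

(** The truncated subtraction in [betti] is harmless because boundaries are
    cycles. *)
Lemma reduced_bettiS X n : subset_closed X ->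
  reduced_betti F X n.+1 =
  #|` faces_card X n.+2|%:R - (\rank (boundary F X n.+1))%:R
  - (\rank (boundary F X n.+2))%:R.
Proof.
move=> cX; rewrite /reduced_betti /betti /cycles /= mxrank_ker subr0.
have := mulmx0_rank_max (boundary_mul0 n.+1 cX).
move=> h; rewrite -!subzn ?natz //; first by rewrite rank_leq_row.
by rewrite leq_subRL ?rank_leq_row // addnC.
Qed.

Lemma sum_reduced_betti X l : subset_closed X -> fset0 \in X ->
  \sum_(0 <= i < l.+1) (-1) ^+ (l - i) * reduced_betti F X i = alt_betti X l.
Proof.
move=> cX X0.
have f0 : #|` faces_card X 0| = 1%N.
  suff -> : faces_card X 0 = [fset fset0] by rewrite cardfs1.
  apply/fsetP => s; rewrite mem_faces_card inE cardfs_eq0.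
  by case: eqP => [->|]; rewrite ?X0 ?andbF.
elim: l => [|l IH].
  rewrite big_nat1 subnn mul1r reduced_betti0 /alt_betti big_nat_recr //= big_nat1.
  by rewrite f0 subnn; ring.
rewrite alternating_sumS IH reduced_bettiS // /alt_betti.
rewrite [in RHS]alternating_sumS; ring.
Qed.

(** * Adjoining an interval of faces

    The interval from [b] to [b `|` p] is adjoined to a complex that contains
    all faces of [b `|` p] not containing [b].  When [p] has a vertex [v],
    the new faces come in pairs with and without [v], and this is the inverse
    of a collapse, which preserves reduced homology.  When [p] is empty, a single
    face is glued along its boundary. *)

Section Interval.
Variables (X : faceset) (b p : face) (l : nat).
Hypothesis cX : subset_closed X.
Hypothesis dbp : [disjoint b & p]%fset.
Hypothesis bX : b \notin X.
Hypothesis lowX : forall s : face, s `<=` b `|` p -> ~~ (b `<=` s) -> s \in X.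
Let I := face_interval b (b `|` p).
Let Y := X `|` I.

Lemma interval_disjoint : [disjoint X & I]%fset.
Proof.
apply/fdisjointP => s sX; rewrite mem_face_interval; apply: contra bX.
by case/andP => bs _; apply: cX sX bs.
Qed.

Lemma interval_closed : subset_closed Y.
Proof.
move=> s t; rewrite !in_fsetU !mem_face_interval => /orP[sX ts|/andP[bs sbp] ts].
  by rewrite (cX sX ts).
have tbp := fsubset_trans ts sbp.
by have [bt|bt] := boolP (b `<=` t); [rewrite tbp orbT | rewrite lowX].
Qed.

Lemma sum_euler_coef_interval :
  \sum_(s <- Y) euler_coef l #|` s| =
  \sum_(s <- X) euler_coef l #|` s| +
  \sum_(t <- fpowerset p) euler_coef l #|` b `|` t|.
Proof.
rewrite (big_fsetU_disjoint _ _ interval_disjoint) /=; congr (_ + _).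
exact: (big_face_interval _ _ dbp).
Qed.

Lemma rank_boundary_before :
  \rank (boundary F X l.+1) =
  \rank (boundary_span Y (faces_card X l.+2)).
Proof.
apply: rank_boundary => //; apply/fsubsetP => s; rewrite mem_faces_card.
by case/andP => sX _; rewrite in_fsetU sX.
Qed.

Lemma rank_boundary_after :
  \rank (boundary F Y l.+1) =
  \rank (boundary_span Y (faces_card Y l.+2)).
Proof.
apply: rank_boundary; first exact: interval_closed.
by apply/fsubsetP => s; rewrite mem_faces_card => /andP[].
Qed.

(** A new face with at most [l + 1] vertices does not alter the boundary operator
    whose rank enters [alt_betti].  With [l + 2] vertices it alters the rank only,
    which can only grow; this is the source of the inequality. *)
Lemma alt_betti_add_face : p = fset0 ->
  alt_betti Y l <= alt_betti X l + euler_coef l #|` b| /\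
  ((#|` b| < l.+2)%N -> alt_betti Y l = alt_betti X l + euler_coef l #|` b|).
Proof.
move=> p0.
have eI : I = [fset b].
  apply/fsetP => s; rewrite mem_face_interval p0 fsetU0 inE.
  by rewrite eqEfsubset andbC.
rewrite !alt_bettiE sum_euler_coef_interval p0 fpowerset0 big_seq_fset1 fsetU0.
rewrite rank_boundary_before rank_boundary_after.
split=> [|bl].
  rewrite [leRHS]addrAC lerB // ler_nat; apply: rank_boundary_span_le => s.
  rewrite mem_faces_card => /andP[sX sl]; apply: boundary_row_sub_span.
  by rewrite mem_faces_card in_fsetU sX.
rewrite addrAC; congr (_ - _%:R + _).
have -> // : faces_card Y l.+2 = faces_card X l.+2.
apply/fsetP => s; rewrite !mem_faces_card in_fsetU eI in_fset1.
case: eqP => [->|]; last by rewrite orbF.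
by rewrite (ltn_eqF bl) !andbF.
Qed.

(** The truncated Euler characteristic grows by the number of new faces with
    [l + 2] vertices that contain [v], and so does the rank: such a face [s]
    has the pivot [s `\ v], while the boundary of a new face [s] without [v] is,
    by [boundary_boundary] on [v |` s], a combination of boundaries of old faces
    and of new faces through [v]. *)
Lemma alt_betti_add_interval v : v \in p -> alt_betti Y l = alt_betti X l.
Proof.
move=> vp.
have vb : v \notin b by move/fdisjointP_sym: dbp; apply.
pose p' := p `\ v.
have vp' : v \notin p' by rewrite !inE eqxx.
have ep : p = v |` p' by rewrite fsetD1K.
pose Q := [seq t <- fpowerset p' | #|` b `|` t| == l.+1].
pose r' := [seq v |` (b `|` t) | t <- Q].
have Qv t : t \in Q -> v \notin b `|` t.
  rewrite mem_filter fpowersetE => /andP[_ /fsubsetP tp].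
  by rewrite in_fsetU negb_or vb (contra (tp v)).
have r'P s : reflect [/\ b `<=` s, s `<=` b `|` p, v \in s & #|` s| = l.+2]
                     (s \in r').
  apply: (iffP mapP) => [[t tQ ->]|[bs sbp vs sl]].
    have := Qv t tQ; move: tQ; rewrite mem_filter fpowersetE.
    move=> /andP[/eqP tl tp'] vt; split.
    - by rewrite (fsubset_trans (fsubsetUl b t)) // fsubsetUr.
    - rewrite ep fsetUCA; apply/fsetUS/fsetUS; exact: tp'.
    - exact: fset1U1.
    - by rewrite cardfsU1 vt tl.
  have bsv : b `<=` s `\ v.
    by rewrite fsubsetD1 bs vb.
  exists ((s `\ v) `\` b).
    rewrite mem_filter fsetUDl fsetDv fsetD0 (fsetUidPr _ _ bsv) (card_facet vs sl).
    rewrite eqxx fpowersetE fsubDset fsubDset fsetUCA -ep.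
    exact: sbp.
  by rewrite fsetUDl fsetDv fsetD0 (fsetUidPr _ _ bsv) fsetD1K.
have sr' : \sum_(t <- fpowerset p) euler_coef l #|` b `|` t| = (size r')%:R.
  rewrite ep big_fpowersetU1 //= -big_split /= size_map size_filter -sum1_count.
  rewrite natr_sum [RHS]big_mkcond /=; apply: eq_big_seq => t.
  rewrite fpowersetE => /fsubsetP tp.
  have vt : v \notin b `|` t by rewrite in_fsetU negb_or vb (contra (tp v)).
  by rewrite fsetUCA (cardfsU1 v) vt add1n euler_coefS; case: eqP.
have ur' : uniq r'.
  rewrite map_inj_in_uniq ?filter_uniq ?fset_uniq // => t t' tQ t'Q e.
  have bt w : w \in Q -> (b `|` w) `\` b = w.
    rewrite mem_filter fpowersetE => /andP[_ wp].
    rewrite fsetDUl fsetDv fset0U; apply/fsetDidPl; rewrite fdisjoint_sym.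
    apply: fdisjointWr dbp; apply: fsubset_trans wp _; exact: fsubD1set.
  by rewrite -(bt t) // -(fsetU1K (Qv _ tQ)) e (fsetU1K (Qv _ t'Q)) bt.
have pivot : \rank (boundary_span Y (r' ++ faces_card X l.+2)) =
    (size r' + \rank (boundary_span Y (faces_card X l.+2)))%N.
  apply: (rank_boundary_span_pivot (c := fun s => s `\ v)) => //.
  - move=> s /r'P[bs sbp vs sl]; rewrite in_fsetU mem_face_interval.
    rewrite fsubsetD1 bs vb (fsubset_trans (fsubD1set s v) sbp).
    by rewrite orbT.
  - by move=> s /r'P[bs sbp vs sl]; rewrite incidence_facet // signr_eq0.
  - move=> s t /r'P[bs sbp vs sl]; rewrite mem_cat => tr ts; apply/eqP.
    apply: contraNT ts => /incidence_neq0[w wt e].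
    case/orP: tr => [/r'P[bt tbp vt tl]|].
      have [wv|wv] := eqVneq w v.
        by rewrite -(fsetD1K vs) e wv fsetD1K.
      have : v \in t `\ w by rewrite !inE eq_sym wv.
      by rewrite -e !inE eqxx.
    rewrite mem_faces_card => /andP[tX _]; case/negP: bX.
    apply: cX tX _; apply: fsubset_trans (fsubD1set t w); rewrite -e.
    by rewrite fsubsetD1 bs vb.
  - move=> s /r'P[bs sbp vs sl]; rewrite mem_faces_card sl eqxx andbT.
    by apply: contra bX => sX; apply: cX sX bs.
have rank_after : \rank (boundary_span Y (faces_card Y l.+2)) =
             \rank (boundary_span Y (r' ++ faces_card X l.+2)).
  apply/eqP; rewrite eqn_leq; apply/andP; split; apply: rank_boundary_span_le => s.
    rewrite mem_faces_card in_fsetU mem_face_interval => /andP[sY /eqP sl].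
    have [sX|sX] := boolP (s \in X).
      apply: boundary_row_sub_span.
      by rewrite mem_cat mem_faces_card sX sl eqxx orbT.
    move: sY; rewrite (negPf sX) /= => /andP[bs sbp].
    have [vs|vs] := boolP (v \in s).
      by apply: boundary_row_sub_span; rewrite mem_cat; apply/orP; left; apply/r'P.
    (* [v |` s] need not be a face; only its facets other than [s] are used. *)
    pose s' := v |` s.
    have vs' : v \in s' by exact: fset1U1.
    have e0 : \sum_(w <- s') vertex_sign w s' *: boundary_row Y (s' `\ w) = 0.
      apply/rowP => j; rewrite summxE mxE.
      rewrite -[RHS](boundary_boundary s' (nth fset0 Y j)).
      by apply: eq_bigr => w _; rewrite !mxE.
    move/eqP: e0; rewrite (big_fsetD1 v vs') /= fsetU1K // addrC addr_eq0.
    rewrite -scaleNr => /eqP e0.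
    have n0 : - vertex_sign v s' != 0 by rewrite oppr_eq0 signr_eq0.
    rewrite -(eqmx_scale _ n0) -e0 big_seq; apply: summx_sub => w ws.
    apply: scalemx_sub; apply: boundary_row_sub_span.
    rewrite mem_cat.
    have vw : v != w by apply: contraNneq vs => ->.
    have sl' : #|` s' `\ w| = l.+2.
      by apply: card_facet; rewrite ?inE ?ws ?orbT // cardfsU1 vs sl.
    have sub : s' `\ w `<=` b `|` p.
      apply: fsubset_trans (fsubD1set _ _) _; rewrite fsubUset fsub1set sbp.
      by rewrite in_fsetU vp orbT.
    apply/orP; have [bw|bw] := boolP (b `<=` s' `\ w).
      by left; apply/r'P; split=> //; rewrite !inE vw eqxx.
    by right; rewrite mem_faces_card sl' eqxx lowX.
  rewrite mem_cat => sr; apply: boundary_row_sub_span.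
  rewrite mem_faces_card in_fsetU mem_face_interval.
  case/orP: sr => [/r'P[-> -> _ ->]|]; first by rewrite orbT eqxx.
  by rewrite mem_faces_card => /andP[-> ->].
rewrite !alt_bettiE sum_euler_coef_interval sr'.
rewrite rank_boundary_before rank_boundary_after rank_after pivot natrD.
ring.
Qed.

End Interval.
End Chains.

(** * Complexes with the same faces of small cardinality *)

Lemma cardfsU_disjoint (s t : face) :
  [disjoint s & t]%fset -> #|` s `|` t| = (#|` s| + #|` t|)%N.
Proof. by move=> /eqP st; rewrite cardfsU st cardfs0 subn0. Qed.

Lemma mem_induced X A s : (s \in induced X A) = (s \in X) && (s `<=` A).
Proof. by rewrite !inE. Qed.

Lemma induced_closed X A : subset_closed X -> subset_closed (induced X A).
Proof.
move=> cX s t; rewrite !mem_induced => /andP[sX sA] ts.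
by rewrite (cX s) //= (fsubset_trans ts).
Qed.

Definition low_eq (N : nat) (X Y : faceset) :=
  forall s : face, (#|` s| <= N)%N -> (s \in X) = (s \in Y).

Lemma low_eq_induced N X Y A :
  low_eq N X Y -> low_eq N (induced X A) (induced Y A).
Proof. by move=> e s sN; rewrite !mem_induced e. Qed.

Lemma low_eq_faces_card N X Y n :
  low_eq N X Y -> (n <= N)%N -> faces_card X n = faces_card Y n.
Proof.
move=> e nN; apply/fsetP => s; rewrite !mem_faces_card.
by case: eqP => [sn|]; rewrite ?andbF // !andbT e ?sn.
Qed.

Lemma low_eq_g_vector N d X Y j :
  low_eq N X Y -> (j <= N)%N -> g_vector d X j = g_vector d Y j.
Proof.
move=> e jN; apply: eq_big_nat => n /andP[_ nj].
by rewrite (low_eq_faces_card e) //; lia.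
Qed.

Lemma g_vectorE d X j : g_vector d X j = \sum_(s <- X) g_coef d.+2 j #|` s|.
Proof. by rewrite /g_vector sum_faces_card. Qed.

Lemma g_vector_interval d X a b j :
  subset_closed X -> [disjoint b & a]%fset -> b \notin X ->
  (#|` b| + #|` a|)%N = d.+2 ->
  g_vector d (X `|` face_interval b (b `|` a)) j =
  g_vector d X j + (j == #|` b|)%:R.
Proof.
move=> cX dba bX hab.
rewrite !g_vectorE (big_fsetU_disjoint _ _ (interval_disjoint a cX bX)) /=.
congr (_ + _); rewrite (big_face_interval _ _ dba) -hab.
rewrite -(sum_powerset_g_coef _ _ a); apply: eq_big_seq => t.
rewrite fpowersetE => ta; rewrite cardfsU_disjoint //.
exact: fdisjointWr dba.
Qed.

(** * Weighted averages over induced subcomplexes *)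

Section Weighted.
Variable F : fieldType.

Lemma low_eq_rank N X Y n : low_eq N X Y -> (n.+1 <= N)%N ->
  \rank (boundary F X n) = \rank (boundary F Y n).
Proof.
move=> e nN; rewrite /boundary.
by rewrite (low_eq_faces_card e nN) (low_eq_faces_card e (ltnW nN)).
Qed.

Lemma low_eq_alt_betti N X Y l : low_eq N X Y -> (l.+2 <= N)%N ->
  alt_betti F X l = alt_betti F Y l.
Proof.
move=> e lN; rewrite /alt_betti (low_eq_rank e lN); congr (_ - _).
apply: eq_big_nat => n /andP[_ nl].
by rewrite (low_eq_faces_card e) //; lia.
Qed.

Lemma low_eq_reduced_betti N X Y i : low_eq N X Y -> (i.+2 <= N)%N ->
  reduced_betti F X i = reduced_betti F Y i.
Proof.
move=> e iN; rewrite /reduced_betti /betti (low_eq_rank e iN) /cycles /boundary.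
by rewrite (low_eq_faces_card e (ltnW iN)) (low_eq_faces_card e (ltnW (ltnW iN))).
Qed.

(** The weight of [A] is the one of the sigma-vector: all cardinalities count
    equally, and all sets of a given cardinality count equally. *)
Definition average (V : {fset nat}) (G : face -> int) : rat :=
  \sum_(A <- fpowerset V) ('C(#|` V|, #|` A|)%:R)^-1 * (G A)%:~R.

Lemma sigma_vectorE X i :
  sigma_vector F X i =
  average (vertices X) (fun A => reduced_betti F (induced X A) i).
Proof.
rewrite /sigma_vector /average.
under eq_bigr => j _ do rewrite mulr_sumr.
rewrite (exchange_big_dep xpredT) //=; apply: eq_big_seq => A.
rewrite fpowersetE => /fsubset_leq_card hA.
under eq_bigl => j do rewrite eq_sym.
rewrite big_mkcond /= (bigD1_seq #|` A|) ?iota_uniq ?mem_index_iota //=.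
rewrite eqxx big1 ?addr0 // => n; by move=> /negPf ->.
Qed.

Lemma eq_average V G H : G =1 H -> average V G = average V H.
Proof. by move=> e; apply: eq_bigr => A _; rewrite e. Qed.

Lemma average_sum V l (G : nat -> face -> int) :
  \sum_(0 <= i < l.+1) (-1) ^+ (l - i) * average V (G i) =
  average V (fun A => \sum_(0 <= i < l.+1) (-1) ^+ (l - i) * G i A).
Proof.
rewrite /average; under eq_bigr => i _ do rewrite mulr_sumr.
rewrite exchange_big; apply: eq_bigr => A _ /=.
rewrite raddf_sum mulr_sumr; apply: eq_bigr => i _.
by rewrite /= rmorphM rmorphXn rmorphN1 mulrCA.
Qed.

Definition gsum (d m : nat) (X : faceset) (l : nat) : rat :=
  (m + 1)%:R / (d + 3)%:R *
  \sum_(0 <= i < l.+2)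
     (-1) ^+ (l + 1 - i) * ((g_vector d X i)%:~R / 'C(d + 2, i)%:R).

(** The gap in the inequality.  The averaging runs over the subsets of a fixed
    [V], which may be larger than the vertex set, so that complexes with
    different vertex sets can be compared. *)
Definition defect (d : nat) (V : {fset nat}) (X : faceset) (l : nat) : rat :=
  gsum d #|` V| X l - average V (fun A => alt_betti F (induced X A) l).

(** The complex [Y] arises from [X] by adjoining the interval from [b] to
    [b `|` a], up to faces with more than [N] vertices. *)
Section Step.
Variables (d N l : nat) (V a b : face) (X Y : faceset).
Hypothesis cX : subset_closed X.
Hypothesis dba : [disjoint b & a]%fset.
Hypothesis bX : b \notin X.
Hypothesis lowX : forall s : face, s `<=` b `|` a -> ~~ (b `<=` s) -> s \in X.
Hypothesis hab : (#|` b| + #|` a|)%N = d.+2.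
Hypothesis lowY : low_eq N Y (X `|` face_interval b (b `|` a)).
Hypothesis baV : b `|` a `<=` V.
Hypothesis lN : (l.+2 <= N)%N.

(* The sets [A] for which a single face, [b] itself, is adjoined to the induced
   subcomplex on [A]. *)
Let hit (A : face) := (b `<=` A) && [disjoint A & a]%fset.

Lemma average_hit :
  \sum_(A <- fpowerset V) ('C(#|` V|, #|` A|)%:R)^-1 * (hit A)%:R =
  (#|` V| + 1)%:R / (d + 3)%:R / 'C(d + 2, #|` b|)%:R :> rat.
Proof.
under eq_bigr => A _ do rewrite mulr_natr mulrb.
pose p := V `\` (b `|` a).
have dbp : [disjoint b & p]%fset.
  by apply/fdisjointP => x xb; rewrite !inE xb.
rewrite -big_mkcond big_fset_condE.
have -> : [fset A in fpowerset V | hit A] = face_interval b (b `|` p).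
  apply/fsetP => A; rewrite mem_face_interval !inE /= fpowersetE /hit.
  rewrite andbCA -fsubsetD; congr (_ && _).
  have -> // : V `\` a = b `|` p.
  apply/fsetP => x; rewrite !inE.
  move/fsubsetP: baV => /(_ x); move/fdisjointP: dba => /(_ x); rewrite !inE.
  by case: (x \in b); case: (x \in a); case: (x \in V) => //= h1 h2;
     move: (h1 isT) (h2 isT).
rewrite (big_face_interval _ _ dbp).
have eV : #|` V| = (#|` a| + #|` b| + #|` p|)%N.
  rewrite -(cardfsID (b `|` a) V) (fsetIidPr baV) (cardfsU_disjoint dba).
  by rewrite (addnC #|` a|).
rewrite (eq_big_seq (fun t : face =>
   ('C(#|` a| + #|` b| + #|` p|, #|` b| + #|` t|)%:R : rat)^-1)) => [|t].
  rewrite sum_powerset_harmonic -eV addnC hab addn1.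
  by rewrite addn3 addn2.
rewrite fpowersetE => tp; rewrite -eV cardfsU_disjoint //.
exact: fdisjointWr dbp.
Qed.

Let Z := X `|` face_interval b (b `|` a).

Lemma induced_miss A : ~~ (b `<=` A) -> induced Z A = induced X A.
Proof.
move=> bA; apply/fsetP => s; rewrite !mem_induced in_fsetU mem_face_interval.
have [sA|] := boolP (s `<=` A); rewrite ?andbF // !andbT.
have bs : ~~ (b `<=` s) by apply: contra bA => bs; exact: fsubset_trans bs sA.
by rewrite (negPf bs) orbF.
Qed.

Lemma induced_hit A : b `<=` A ->
  induced Z A = induced X A `|` face_interval b (b `|` (a `&` A)).
Proof.
move=> bA; apply/fsetP => s.
rewrite in_fsetU !mem_induced in_fsetU !mem_face_interval.
rewrite fsetUIr (fsetUidPr _ _ bA) fsubsetI.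
by rewrite andb_orl !andbA.
Qed.

Lemma alt_betti_induced_step A :
  alt_betti F (induced Z A) l
    <= alt_betti F (induced X A) l + (hit A)%:R * euler_coef l #|` b| /\
  ((#|` b| < l.+2)%N ->
   alt_betti F (induced Z A) l =
   alt_betti F (induced X A) l + (hit A)%:R * euler_coef l #|` b|).
Proof.
have [bA|bA] := boolP (b `<=` A); last first.
  by rewrite induced_miss // /hit (negPf bA) mul0r addr0.
pose p := a `&` A.
have cXA := induced_closed (A := A) cX.
have dbp : [disjoint b & p]%fset by apply: fdisjointWr dba; apply: fsubsetIl.
have bXA : b \notin induced X A by rewrite mem_induced (negPf bX).
have lowXA s : s `<=` b `|` p -> ~~ (b `<=` s) -> s \in induced X A.
  move=> sp bs; rewrite mem_induced lowX //=; apply: fsubset_trans sp _.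
    by rewrite fsubUset bA fsubsetIr.
  by apply: fsetUS; apply: fsubsetIl.
rewrite induced_hit // /hit bA /=.
have [p0|/fset0Pn[v vp]] := eqVneq p fset0.
  have -> : [disjoint A & a]%fset by apply/eqP; rewrite fsetIC.
  by rewrite mul1r; apply: alt_betti_add_face.
rewrite (alt_betti_add_interval F l cXA dbp bXA lowXA vp).
suff /negPf -> : ~~ [disjoint A & a]%fset by rewrite mul0r addr0.
by apply/negP => /eqP h; move: vp; rewrite /p fsetIC h inE.
Qed.

Lemma gsum_step :
  gsum d #|` V| Y l = gsum d #|` V| X l +
    (euler_coef l #|` b|)%:~R *
    ((#|` V| + 1)%:R / (d + 3)%:R / 'C(d + 2, #|` b|)%:R).
Proof.
rewrite /gsum [X in _ = _ + X]mulrCA -mulrDr; congr (_ * _).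
have -> : \sum_(0 <= i < l.+2)
     (-1) ^+ (l + 1 - i) * ((g_vector d Y i)%:~R / 'C(d + 2, i)%:R) =
  \sum_(0 <= i < l.+2)
     (-1) ^+ (l + 1 - i) * ((g_vector d X i)%:~R / 'C(d + 2, i)%:R) +
  \sum_(0 <= i < l.+2)
     (-1) ^+ (l + 1 - i) * ((i == #|` b|)%:R / 'C(d + 2, i)%:R) :> rat.
  rewrite -big_split; apply: eq_big_nat => i /andP[_ il] /=.
  rewrite -mulrDr -mulrDl.
  rewrite (low_eq_g_vector _ lowY) ?g_vector_interval //; last by lia.
  by rewrite rmorphD /= rmorph_nat.
congr (_ + _); rewrite /euler_coef; case: ltnP => bl.
  rewrite (bigD1_seq #|` b|) ?iota_uniq ?mem_index_iota //= eqxx mul1r.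
  rewrite big1 ?addr0 => [|i /negPf ->]; last by rewrite mul0r mulr0.
  by rewrite rmorphXn rmorphN1 addn1.
rewrite mulr0z mul0r big1_seq // => i; rewrite mem_index_iota => /andP[_ il].
by case: eqP => [e|_]; [move: il; rewrite e; lia | rewrite mul0r mulr0].
Qed.

(** The average of [alt_betti] and the g-vector side increase by the same
    amount, the weight of the sets [A] containing [b] and disjoint from [a],
    up to a possible growth of rank when [b] has [l + 2] vertices. *)
Lemma defect_step :
  defect d V X l <= defect d V Y l /\
  ((#|` b| < l.+2)%N -> defect d V Y l = defect d V X l).
Proof.
have eY : average V (fun A => alt_betti F (induced Y A) l) =
          average V (fun A => alt_betti F (induced Z A) l).
  apply: eq_average => A; apply: low_eq_alt_betti lN; exact: low_eq_induced lowY.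
have eX : average V (fun A => alt_betti F (induced X A) l) +
    (euler_coef l #|` b|)%:~R *
    ((#|` V| + 1)%:R / (d + 3)%:R / 'C(d + 2, #|` b|)%:R) =
   average V (fun A =>
     alt_betti F (induced X A) l + (hit A)%:R * euler_coef l #|` b|).
  rewrite -average_hit mulr_sumr -big_split; apply: eq_bigr => A _ /=.
  by rewrite intrD intrM rmorph_nat; ring.
rewrite /defect gsum_step eY; split=> [|bl].
  rewrite -subr_ge0 [X in 0 <= X](_ : _ =
      average V (fun A =>
     alt_betti F (induced X A) l + (hit A)%:R * euler_coef l #|` b|)
      - average V (fun A => alt_betti F (induced Z A) l)); last by rewrite -eX; ring.
  rewrite subr_ge0; apply: ler_sum => A _; apply: ler_wpM2l.
    by rewrite invr_ge0 ler0n.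
  by rewrite ler_int; have [] := alt_betti_induced_step A.
have -> : average V (fun A => alt_betti F (induced Z A) l) =
   average V (fun A =>
     alt_betti F (induced X A) l + (hit A)%:R * euler_coef l #|` b|).
  by apply: eq_average => A; have [_ ->] := alt_betti_induced_step A.
by rewrite -eX; ring.
Qed.

End Step.

(** * Bistellar moves *)

Lemma mem_vertices (X : faceset) v : subset_closed X ->
  (v \in vertices X) = ([fset v] \in X).
Proof.
move=> cX; rewrite /vertices; apply/bigfcupP/idP => [[s /andP[sX _] vs]|vX].
  by apply: cX sX _; rewrite fsub1set.
by exists [fset v]; rewrite ?vX ?inE.
Qed.

Lemma mem_join_boundary (a b s : face) : [disjoint a & b]%fset ->
  (s \in join (simplex a) (simplex_boundary b)) =
  (s `<=` a `|` b) && ~~ (b `<=` s).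
Proof.
move=> dab; apply/imfset2P/andP => /= [[x xa [y]]|[sab bs]].
  rewrite !inE /= !fpowersetE in xa * => /andP[yb yB] ->; split.
    exact: fsetUSS.
  apply: contra yb => bxy; rewrite eqEfsubset yB /=.
  apply/fsubsetP => v vb; move/fsubsetP: bxy => /(_ v vb); rewrite inE.
  case/orP => // vx; move/fdisjointP: dab => /(_ v).
  by move/fsubsetP: xa => /(_ v vx) va /(_ va); rewrite vb.
exists (s `&` a); rewrite ?fpowersetE ?fsubsetIr //.
exists (s `&` b).
  rewrite !inE fpowersetE fsubsetIr andbT; apply: contra bs => /eqP <-.
  exact: fsubsetIl.
by rewrite -fsetIUr; apply/esym/fsetIidPl.
Qed.

Lemma mem_join_boundaryl (a b s : face) : [disjoint a & b]%fset ->
  (s \in join (simplex_boundary a) (simplex b)) =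
  (s `<=` a `|` b) && ~~ (a `<=` s).
Proof.
move=> dab; rewrite fsetUC -mem_join_boundary 1?fdisjoint_sym //.
by apply/imfset2P/imfset2P => /= -[x xa [y yb ->]]; exists y => //;
   exists x => //; rewrite fsetUC.
Qed.

Section Move.
Variables (d : nat) (X Y : faceset) (a b : face).
Hypothesis hmove : bistellar_move d X a b Y.

Lemma move_cards : (#|` b| + #|` a|)%N = d.+2.
Proof.
case: hmove => _ [a0 b0 _] <- _ _; rewrite -!cardfs_gt0 in a0 b0.
by rewrite /face_dim; lia.
Qed.

Lemma move_disjoint : [disjoint b & a]%fset.
Proof. by case: hmove => _ [_ _ ?] _ _ _; rewrite fdisjoint_sym. Qed.

Lemma move_induced s : s `<=` b `|` a -> (s \in X) = ~~ (b `<=` s).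
Proof.
case: hmove => _ [_ _ dab] _ e _; rewrite fsetUC => sab.
by have /fsetP/(_ s) := e; rewrite mem_induced mem_join_boundary // sab andbT.
Qed.

(** All faces deleted by the move contain [a], so they are invisible below the
    cardinality of [a]. *)
Lemma move_low N : (N < #|` a|)%N ->
  low_eq N Y (X `|` face_interval b (b `|` a)).
Proof.
case: (hmove) => _ [_ _ dab] _ _ eY Na s sN.
have as_ : ~~ (a `<=` s).
  by apply/negP => /fsubset_leq_card; lia.
rewrite eY !in_fsetU in_fsetD mem_join_boundary // mem_join_boundaryl // as_.
rewrite mem_face_interval (fsetUC b a) andbT.
have [sab|sab] := boolP (s `<=` a `|` b); last by rewrite !andbF.
by rewrite move_induced 1?fsetUC // !andbT; case: (b `<=` s).
Qed.

Lemma move_vertices : (1 < #|` a|)%N ->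
  b `|` a `<=` vertices Y /\ vertices X `<=` vertices Y.
Proof.
move=> a1; have lowY := move_low a1.
have [cX _ ] : is_complex X /\ complex_dim X = d by case: hmove.
have vY v : [fset v] \in Y -> v \in vertices Y.
  by move=> vY; apply/bigfcupP; exists [fset v]; rewrite ?vY ?inE.
split; apply/fsubsetP => v hv; apply: vY; rewrite lowY ?cardfs1 // in_fsetU.
  rewrite mem_face_interval move_induced ?fsub1set ?hv ?andbT //.
  by case: (_ `<=` _).
by rewrite -mem_vertices ?hv //; case: cX.
Qed.

End Move.

(** The invariant of a sequence of moves.  The result of a move enters only
    through its faces with at most [d + 1 - k] vertices: these agree with those
    of a complex, and they determine the g-numbers and averages involved.
    That the result itself is closed under passing to subsets would depend on
    the links in the sphere. *)
Record low_control (k d : nat) (S : faceset) : Prop := LowControl {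
  low_complex : exists Z, [/\ subset_closed Z, fset0 \in Z &
                              low_eq (d.+1 - k) S Z];
  low_g0 : forall j, (k < j)%N -> (j <= d - k)%N -> g_vector d S j = 0;
  low_defect : forall V l, vertices S `<=` V -> (l + k + 1 <= d)%N ->
    0 <= defect d V S l /\ ((k <= l + 1)%N -> defect d V S l = 0)
}.

Lemma defect0 d V l : defect d V fset0 l = 0.
Proof.
have g0 j : g_vector d fset0 j = 0 by rewrite g_vectorE big_seq_fset0.
rewrite /defect /gsum big1 ?mulr0 => [|i _]; last by rewrite g0 mul0r mulr0.
rewrite /average big1 ?subr0 // => A _.
have -> : induced fset0 A = fset0 by apply/fsetP => s; rewrite mem_induced !inE.
rewrite alt_bettiE big_seq_fset0.
suff -> : \rank (boundary F fset0 l.+1) = 0%N by rewrite subr0 mulr0.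
have e : faces_card fset0 l.+2 = fset0 by apply/fsetP => s; rewrite !inE.
apply/eqP; rewrite -leqn0 (leq_trans (rank_leq_row _)) //.
by rewrite e cardfs0.
Qed.

(** The standard sphere on [c] also arises, in low cardinalities, by adjoining
    an interval: the one from the empty set to [c], to the complex without any
    face.  A move of index less than [k] adjoins an interval from a [b] with at
    most [k] vertices, hence preserves equality of both sides once
    [k <= l + 1]. *)
Lemma stellated_low_control k d S : (1 <= k)%N -> (2 * k - 1 <= d)%N ->
  stellated k d S -> low_control k d S.
Proof.
move=> hk hd; elim=> {S} [c hc|X Y a b _ IH hmove hb].
  have dc : [disjoint fset0 & c]%fset by exact: fdisjoint0X.
  have c0 : subset_closed fset0 by move=> s t; rewrite inE.
  have b0 : fset0 \notin (fset0 : faceset) by rewrite inE.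
  have low0 (s : face) : s `<=` fset0 `|` c -> ~~ (fset0 `<=` s) ->
     s \in (fset0 : faceset) by rewrite fsub0set.
  have hfc : (#|` @fset0 nat| + #|` c|)%N = d.+2 by rewrite cardfs0.
  have lowS : low_eq (d.+1 - k) (simplex_boundary c)
                (fset0 `|` face_interval fset0 (fset0 `|` c)).
    move=> s sd; rewrite in_fsetU in_fset0 mem_face_interval fsub0set !fset0U /=.
    rewrite !inE /= fpowersetE; case: eqP => // e; move: sd; rewrite e hc; lia.
  split.
  - exists (fset0 `|` face_interval fset0 (fset0 `|` c)); split => //.
      exact: interval_closed.
    by rewrite in_fsetU mem_face_interval !fsub0set orbT.
  - move=> j kj jd; rewrite (low_eq_g_vector d lowS); last by lia.
    rewrite g_vector_interval // g_vectorE big_seq_fset0 cardfs0.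
    by case: j kj {jd}.
  - move=> V l sV ld.
    have cV : fset0 `|` c `<=` V.
      rewrite fset0U; apply: fsubset_trans sV; apply/fsubsetP => v vc.
      apply/bigfcupP; exists [fset v]; rewrite ?inE //= fpowersetE fsub1set vc.
      by rewrite !andbT; apply/eqP => e; move: hc; rewrite -e cardfs1.
    have lN : (l.+2 <= d.+1 - k)%N by lia.
    have [h1 h2] := defect_step c0 dc b0 low0 hfc lowS cV lN.
    rewrite defect0 in h1 h2; split=> // _.
    by apply: h2; rewrite cardfs0.
have hcard := move_cards hmove.
have dba := move_disjoint hmove.
have bk : (#|` b| <= k)%N by move: hb; rewrite /face_dim; lia.
have Na : (d.+1 - k < #|` a|)%N by lia.
have lowY := move_low hmove Na.
have [cX X0] : subset_closed X /\ fset0 \in X.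
  by case: (hmove) => [[[]]].
have bX : b \notin X by rewrite (move_induced hmove) ?fsubsetUl // fsubset_refl.
have lowX (s : face) : s `<=` b `|` a -> ~~ (b `<=` s) -> s \in X.
  by move=> sab; rewrite (move_induced hmove).
case: IH => _ g0 def0.
split.
- exists (X `|` face_interval b (b `|` a)); split => //.
    exact: interval_closed.
  by rewrite in_fsetU X0.
- move=> j kj jd; rewrite (low_eq_g_vector d lowY); last by lia.
  rewrite g_vector_interval // g0 //.
  by case: eqP => // e; move: kj; rewrite e; lia.
- move=> V l sV ld.
  have a1 : (1 < #|` a|)%N by lia.
  have [baY XY] := move_vertices hmove a1.
  have lN : (l.+2 <= d.+1 - k)%N by lia.
  have [h1 h2] := defect_step cX dba bX lowX hcard lowY
                    (fsubset_trans baY sV) lN.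
  have [h3 h4] := def0 V l (fsubset_trans XY sV) ld.
  split; first exact: le_trans h1.
  by move=> kl; rewrite h2 ?h4 //; lia.
Qed.

Lemma sum_sigma_vector k d S l : low_control k d S -> (l + k + 1 <= d)%N ->
  \sum_(0 <= i < l.+1) (-1) ^+ (l - i) * sigma_vector F S i =
  average (vertices S) (fun A => alt_betti F (induced S A) l).
Proof.
case=> -[Z [cZ Z0 lowZ]] _ _ ld.
under eq_bigr => i _ do rewrite sigma_vectorE.
rewrite average_sum; apply: eq_average => A.
have lowA := low_eq_induced A lowZ.
rewrite (low_eq_alt_betti lowA); last by lia.
rewrite -sum_reduced_betti; first last.
- by rewrite mem_induced Z0 fsub0set.
- exact: induced_closed.
apply: eq_big_nat => i /andP[_ il].
by rewrite (low_eq_reduced_betti lowA) //; lia.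
Qed.
End Weighted.

(* The index bounds i <= d - k - 1, l <= k - 2 and k - 1 <= l are written
   additively because their right-hand sides may be negative. *)
Theorem theorem3p5 (F : fieldType) (k d m : nat) (S : {fset {fset nat}})
    (hk : (1 <= k)%N) (hd : (2 * k - 1 <= d)%N)
    (hS : stellated k d S) (hm : #|` vertices S| = m) :
  [/\ forall i : nat, (k <= i)%N -> (i + k + 1 <= d)%N ->
        sigma_vector F S i = 0,
      forall l : nat, (l + 2 <= k)%N ->
        \sum_(0 <= i < l.+1) (-1) ^+ (l - i) * sigma_vector F S i
        <= (m + 1)%:R / (d + 3)%:R *
           \sum_(0 <= i < l.+2)
             (-1) ^+ (l + 1 - i) * ((g_vector d S i)%:~R / 'C(d + 2, i)%:R)
    & forall l : nat, (k <= l + 1)%N -> (l + k + 1 <= d)%N ->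
        \sum_(0 <= i < l.+1) (-1) ^+ (l - i) * sigma_vector F S i
        = (m + 1)%:R / (d + 3)%:R *
          \sum_(0 <= i < l.+2)
            (-1) ^+ (l + 1 - i) * ((g_vector d S i)%:~R / 'C(d + 2, i)%:R)].
Proof.
have ctrl := stellated_low_control F hk hd hS.
have eqn l : (k <= l + 1)%N -> (l + k + 1 <= d)%N ->
    \sum_(0 <= i < l.+1) (-1) ^+ (l - i) * sigma_vector F S i = gsum d m S l.
  move=> kl ld; rewrite (sum_sigma_vector ctrl) //.
  have [_ /(_ kl)/eqP] := low_defect ctrl (fsubset_refl _) ld.
  by rewrite subr_eq0 hm => /eqP.
split=> [[|i] ki id|l lk|l]; last exact: eqn.
- by move: (leq_trans hk ki).
- have e1 : sigma_vector F S i.+1 = gsum d m S i.+1 + gsum d m S i.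
    rewrite -!eqn; try lia.
    by rewrite alternating_sumS subrK.
  rewrite e1 /gsum -mulrDr !addn1 alternating_sumS subrK.
  by rewrite (low_g0 ctrl) ?mulr0z ?mul0r ?mulr0 //; lia.
- have ld : (l + k + 1 <= d)%N by lia.
  rewrite (sum_sigma_vector ctrl) //.
  have [h _] := low_defect ctrl (fsubset_refl _) ld.
  by rewrite -subr_ge0 -hm.
Qed.
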